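(* Let $n\geq 1$. Let $a(n)$ be the number of partitions of $n$ whose set of even parts has exactly one element; let $c(n)$ be the number of partitions of $n$ in which exactly one part is repeated; and let $b(n)$ be the total number of parts in all partitions of $n$ into odd parts minus the total number of parts in all partitions of $n$ into distinct parts. Then (i) $a(n)=b(n)$, and (ii) $c(n)=b(n)$.
   Context: A partition of $n$ is a non-increasing sequence of positive integers (its parts) summing to $n$; parts are counted with multiplicity. ''The set of even parts has exactly one element'' means exactly one distinct even value occurs among the parts; that value may occur with any positive multiplicity, and odd parts are unrestricted. ''Exactly one part is repeated'' means exactly one distinct value occurs with multiplicity at least $2$. *)

(* Defs.v *)
From HB Require Import structures.
From mathcomp Require Import all_boot all_order all_algebra.
Set Implicit Arguments.
Unset Strict Implicit.
Unset Printing Implicit Defensive.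

Definition is_partition (n : nat) (s : seq nat) : bool :=
  [&& sorted geq s, all (fun k => 0 < k) s & sumn s == n].

Record intpart (n : nat) := IntPart {
  parts :> seq nat;
  partsP : is_partition n parts
}.

HB.instance Definition _ n := [isSub for @parts n].
HB.instance Definition _ n := [Countable of intpart n by <:].

(* Finiteness of [intpart n]: a partition of n has at most n parts, each at
   most n, so it embeds into the finite type [n.-bseq 'I_n.+1]. *)

Lemma leq_part n s k : is_partition n s -> k \in s -> k <= n.
Proof.
case/and3P=> _ _ /eqP <-; elim: s => //= x s IHs.
rewrite inE => /predU1P[-> | /IHs k_le]; first exact: leq_addr.
exact: leq_trans k_le (leq_addl _ _).
Qed.

Lemma size_part n s : is_partition n s -> size s <= n.
Proof.
case/and3P=> _ s_gt0 /eqP <-; elim: s s_gt0 => //= x s IHs /andP[x_gt0 /IHs].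
by rewrite -add1n; apply: leq_add.
Qed.

Definition intpart_bseq n (p : intpart n) : n.-bseq 'I_n.+1 :=
  insub_bseq n (map inord p).

Definition bseq_intpart n (t : n.-bseq 'I_n.+1) : option (intpart n) :=
  insub (map val t).

Lemma intpart_bseqK n : pcancel (@intpart_bseq n) (@bseq_intpart n).
Proof.
move=> p; rewrite /bseq_intpart /intpart_bseq /insub_bseq.
have /= -> : map val (insubd [bseq] (map inord p) : n.-bseq 'I_n.+1) = p.
  rewrite val_insubd size_map (size_part (partsP p)) -map_comp.
  apply: map_id_in => k /(leq_part (partsP p)) k_le /=.
  by rewrite inordK.
exact: valK.
Qed.

HB.instance Definition _ n : isFinite (intpart n) :=
  PCanIsFinite (@intpart_bseqK n).

Definition even_values (s : seq nat) : seq nat :=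
  undup [seq k <- s | ~~ odd k].

Definition repeated_values (s : seq nat) : seq nat :=
  [seq k <- undup s | 1 < count_mem k s].

Definition a (n : nat) : nat :=
  #|[set p : intpart n | size (even_values p) == 1]|.

Definition c (n : nat) : nat :=
  #|[set p : intpart n | size (repeated_values p) == 1]|.

(* An integer, so that the subtraction is not truncated. *)
Definition b (n : nat) : int :=
  ((\sum_(p : intpart n | all odd p) size p)%:Z
   - (\sum_(p : intpart n | uniq p) size p)%:Z)%R.

(* Main.v *)
(* Encode a partition by its multiplicities m_k.  Each of the four counts is
   a sum over partitions of sum_k u(k, m_k) prod_(i != k) v(i, m_i), hence the
   coefficient of q^n in sum_k U_k prod_(i != k) V_i, where U_k and V_k are the
   series with coefficients u(k, j), v(k, j) in q^k.  Factoring out prod V,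
   which by Euler's theorem is the same product P for odd and for distinct
   parts, leaves the Lambert series
     a, c        : P * sum_(k even) q^k / (1 - q^k)
     odd parts   : P * sum_(k odd)  q^k / (1 - q^k)
     distinct    : P * sum_k q^k / (1 + q^k),
   and q^k / (1 + q^k) = q^k / (1 - q^k) - 2 q^(2k) / (1 - q^(2k)).
   All of this takes place in Z[q] / (q^(n+1)), where 1 - q^k is invertible. *)
Require Import Defs.
From mathcomp Require Import all_boot all_order all_algebra.
From mathcomp Require Import ring.

Import GRing.Theory.
Set Implicit Arguments.
Unset Strict Implicit.
Unset Printing Implicit Defensive.

(** * Partitions as multiplicity functions *)

Lemma ord_succ_surj (n x : nat) : 0 < x <= n -> exists k : 'I_n, x = k.+1.
Proof. by case: x => // x /= x_lt; exists (Ordinal x_lt). Qed.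

Lemma sumn_count_mem (n : nat) (s : seq nat) (F : nat -> nat) :
    {in s, forall x, 0 < x <= n} ->
  \sum_(x <- s) F x = \sum_(k < n) count_mem k.+1 s * F k.+1.
Proof.
elim: s => [|x s IHs] s_bnd.
  by rewrite big_nil big1 // => k _; rewrite mul0n.
rewrite big_cons IHs; last by move=> y ys; apply: s_bnd; rewrite inE ys orbT.
have [i ->] := ord_succ_surj (s_bnd x (mem_head _ _)).
under [RHS]eq_bigr => k _ do rewrite /= mulnDl.
rewrite big_split /=; congr (_ + _).
rewrite (bigD1 i) //= eqxx mul1n big1 ?addn0 // => k k_neq.
by rewrite eqSS [_ == _]eq_sym [_ == _](negPf k_neq).
Qed.

Section Multiplicities.
Variable n : nat.
Implicit Types (p : intpart n) (f : {ffun 'I_n -> 'I_n.+1}).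

Lemma part_bounds p : {in (p : seq nat), forall x, 0 < x <= n}.
Proof.
move=> x xp; rewrite (leq_part (partsP p) xp) andbT.
by case/and3P: (partsP p) => _ /allP/(_ x xp).
Qed.

(** Multiplicities are at most n, so [inord] loses nothing; a finite codomain lets sums over these
    functions arise by expanding a product of sums. *)
Definition mults p : {ffun 'I_n -> 'I_n.+1} :=
  [ffun k : 'I_n => inord (count_mem k.+1 p)].

Lemma multsE p k : mults p k = count_mem k.+1 p :> nat.
Proof.
rewrite ffunE inordK // ltnS.
exact: leq_trans (count_size _ _) (size_part (partsP p)).
Qed.

Definition weight f : nat := \sum_(k < n) k.+1 * f k.

Lemma weight_mults p : weight (mults p) = n.
Proof.
case/and3P: (partsP p) => _ _ /eqP <-.
rewrite sumnE (@sumn_count_mem n _ id (@part_bounds p)) /weight.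
by apply: eq_bigr => k _; rewrite multsE mulnC.
Qed.

(** Two sorted lists agree once they are permutations of each other, and a value outside 1..n occurs
    in neither. *)
Lemma mults_inj : injective mults.
Proof.
move=> p1 p2 eq_p; apply: val_inj => /=.
case/and3P: (partsP p1) => sorted1 _ _; case/and3P: (partsP p2) => sorted2 _ _.
apply: (sorted_eq _ _ sorted1 sorted2).
- by move=> x y z yx xz; exact: leq_trans xz yx.
- by move=> x y; rewrite andbC => /anti_leq.
apply/allP => x _ /=; apply/eqP.
have [/ord_succ_surj[k ->]|x_out] := boolP (0 < x <= n).
  by rewrite -!multsE eq_p.
have out (p : intpart n) : count_mem x p = 0.
  by apply/count_memPn; apply: contra x_out => /part_bounds.
by rewrite !out.
Qed.

Lemma mults_surj f : weight f = n -> exists p, mults p = f.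
Proof.
move=> weight_f.
pose t := flatten [seq nseq (f k) k.+1 | k <- enum 'I_n].
pose s := sort geq t.
have count_t (a : pred nat) : count a t = \sum_(k < n) a k.+1 * f k.
  rewrite count_flatten sumnE 2!big_map big_enum /=.
  by apply: eq_bigr => k _; rewrite count_nseq.
have s_part : is_partition n s.
  apply/and3P; split.
  - by apply: sort_sorted => x y; exact: leq_total.
  - rewrite all_sort; apply/allP => x /flattenP[_ /mapP[k _ ->]].
    by rewrite mem_nseq => /andP[_ /eqP ->].
  - rewrite (perm_sumn (_ : perm_eq _ t)) ?perm_sort //.
    rewrite sumn_flatten sumnE 2!big_map big_enum -[X in _ == X]weight_f /=.
    by apply/eqP/eq_bigr => k _; rewrite sumn_nseq.
exists (IntPart s_part); apply/ffunP => k; apply: val_inj.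
rewrite /= multsE /= count_sort count_t (bigD1 k) //= eqxx mul1n.
by rewrite big1 ?addn0 // => i /negPf i_neq; rewrite eqSS [_ == _]i_neq.
Qed.

Lemma sum_mults (R : nmodType) (F : {ffun 'I_n -> 'I_n.+1} -> R) :
  (\sum_(p : intpart n) F (mults p) = \sum_(f | weight f == n) F f)%R.
Proof.
rewrite -(big_imset F (in2W (@mults_inj))) /=; apply: eq_bigl => f.
apply/imsetP/eqP => [[p _ ->]|/mults_surj[p <-]]; last by exists p.
exact: weight_mults.
Qed.

End Multiplicities.

(* One part size k is distinguished and weighted by u, the others by v; the
   index k : 'I_n stands for the part size k.+1. *)
Definition marked (n : nat) (u v : nat -> nat -> nat)
    (f : {ffun 'I_n -> 'I_n.+1}) : nat :=
  \sum_(k < n) u k.+1 (f k) * \prod_(i < n | i != k) v i.+1 (f i).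

(** * Uniqueness as a sum of products of indicators *)

Lemma prod_nat_of_bool (I : finType) (P Q : pred I) :
  \prod_(i | P i) Q i = [forall (i | P i), Q i] :> nat.
Proof.
have [/forall_inP PQ|] := boolP [forall (i | P i), Q i].
  by rewrite big1 // => i /PQ ->.
rewrite negb_forall_in => /exists_inP[i Pi /negPf Qi].
by rewrite (bigD1 i) //= Qi mul0n.
Qed.

(** The summand at k is 1 exactly when A is the singleton of k, which happens for at most one k.
    This gives the counts [a] and [c] the shape of [marked]. *)
Lemma card_eq1_sum (I : finType) (A : pred I) :
  (#|A| == 1) = \sum_k A k * \prod_(i | i != k) ~~ A i :> nat.
Proof.
have [/card1P[x Ax]|A_neq1] := boolP (#|A| == 1).
  have {}Ax i : A i = (i == x) by have := Ax i; rewrite !inE.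
  rewrite (bigD1 x) //= Ax eqxx mul1n.
  rewrite [X in _ + X]big1 ?addn0 => [|i /negPf i_x].
    by rewrite big1 // => i /negPf; rewrite Ax => ->.
  by rewrite Ax i_x.
rewrite big1 // => k _; rewrite prod_nat_of_bool mulnb.
case: forall_inP => [A_k|]; last by rewrite andbF.
rewrite andbT; apply/eqP; rewrite eqb0; apply: contra A_neq1 => Ak.
apply/card1P; exists k => i; rewrite !inE.
have [->|/A_k/negPf] := eqVneq i k; first exact: Ak.
by [].
Qed.

Lemma uniq_size_eq1_sum (n : nat) (s : seq nat) :
    uniq s -> {in s, forall x, 0 < x <= n} ->
  (size s == 1) =
    \sum_(k < n) (k.+1 \in s) * \prod_(i < n | i != k) (i.+1 \notin s) :> nat.
Proof.
move=> s_uniq s_bnd; rewrite -card_eq1_sum; congr (nat_of_bool (_ == _)).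
rewrite -sum1_size (@sumn_count_mem n) // -sum1_card [RHS]big_mkcond /=.
by apply: eq_bigr => k _; rewrite muln1 count_uniq_mem // [in RHS]inE.
Qed.

(** * Generating series at a nilpotent q *)

Section NilpotentBase.
Local Open Scope ring_scope.
Variables (R : comNzRingType) (n : nat) (q : R).
Hypotheses (n_gt0 : (0 < n)%N) (q_nil : q ^+ n.+1 = 0).

Definition term_series (u : nat -> nat -> nat) (k : nat) : R :=
  \sum_(j < n.+1) (u k j)%:R * q ^+ (k * j).

Lemma marked_series u v :
  \sum_(f : {ffun 'I_n -> 'I_n.+1}) (marked u v f)%:R * q ^+ weight f =
  \sum_(k < n) term_series u k.+1 *
    \prod_(i < n | i != k) term_series v i.+1.
Proof.
under eq_bigr => f _ do rewrite natr_sum mulr_suml.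
rewrite exchange_big /=; apply: eq_bigr => k _.
(* Merging u and v into one family gives a single product over all i, to which distributivity
   applies; f records the exponent chosen in each factor. *)
pose w (i : 'I_n) := if i == k then u else v.
have -> : term_series u k.+1 * \prod_(i < n | i != k) term_series v i.+1 =
    \prod_(i < n) term_series (w i) i.+1.
  rewrite [RHS](bigD1 k) //= /w eqxx; congr (_ * _).
  by apply: eq_bigr => i /negPf ->.
rewrite bigA_distr_bigA /=; apply: eq_bigr => f _.
rewrite big_split /= -prodrXr natrM natr_prod; congr (_ * _).
rewrite [RHS](bigD1 k) //= /w eqxx; congr (_ * _).
by apply: eq_bigr => i /negPf ->.
Qed.

(* The inverse of 1 - q^k, since q is nilpotent. *)
Definition geom (k : nat) : R := \sum_(j < n.+1) q ^+ (k * j).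

Lemma q_exp0 (m : nat) : (n < m)%N -> q ^+ m = 0.
Proof. by move=> n_m; rewrite -(subnK n_m) exprD q_nil mulr0. Qed.

(** The geometric sum telescopes to 1 - q^(k(n+1)), whose last power vanishes. *)
Lemma geomK (k : nat) : (0 < k)%N -> (1 - q ^+ k) * geom k = 1.
Proof.
move=> k_gt0; have := subrX1 (q ^+ k) n.+1.
under eq_bigr => j _ do rewrite -exprM.
rewrite -exprM mulnC exprM q_nil expr0n gtn_eqF //= -/(geom k) => gE.
have -> : (1 - q ^+ k) * geom k = - ((q ^+ k - 1) * geom k) by ring.
by rewrite -gE; ring.
Qed.

Lemma geom_eq1 (k : nat) : (n < k)%N -> geom k = 1.
Proof.
move=> n_k; rewrite -[LHS]mul1r -[X in X * _](subr0 1) -(q_exp0 n_k).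
by rewrite geomK // (leq_ltn_trans _ n_k).
Qed.

(** The left side runs over the even numbers up to 2n, and those beyond n contribute the neutral
    element. Since i stands for i + 1, [odd i] selects even part sizes. *)
Lemma big_double (T : Type) (idx : T) (op : Monoid.com_law idx) (F : nat -> T) :
    (forall k, (n < k)%N -> F k = idx) ->
  \big[op/idx]_(i < n) F i.+1.*2 = \big[op/idx]_(i < n | odd i) F i.+1.
Proof.
move=> F_idx.
have double m : \big[op/idx]_(0 <= i < m) F i.+1.*2 =
    \big[op/idx]_(0 <= i < m.*2 | odd i) F i.+1.
  elim: m => [|m IHm]; first by rewrite !big_nil.
  rewrite big_nat_recr //= IHm doubleS big_mkcond [RHS]big_mkcond /=.
  by rewrite !big_nat_recr //= odd_double /= Monoid.mulm1.
rewrite -(big_mkord xpredT (fun i => F i.+1.*2)) double.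
rewrite -(big_mkord odd (fun i => F i.+1)).
rewrite (@big_cat_nat _ _ _ n) //=; last by rewrite -addnn leq_addr.
rewrite [X in op _ X]big_nat_cond [X in op _ X]big1 ?Monoid.mulm1 //.
by move=> i /andP[/andP[n_i _] _]; apply: F_idx.
Qed.

(** The factor [V i] of [U i] fills the gap in the product, so nothing has to be divided. *)
Lemma sum_mul_prod_neq (I : finType) (U V T : I -> R) :
    (forall i, U i = V i * T i) ->
  \sum_i U i * \prod_(j | j != i) V j = (\prod_i V i) * \sum_i T i.
Proof.
move=> UE; rewrite mulr_sumr; apply: eq_bigr => i _.
by rewrite UE [in RHS](bigD1 i) //= mulrAC.
Qed.

Lemma mul_1DB_exp (k : nat) : (1 + q ^+ k) * (1 - q ^+ k) = 1 - q ^+ k.*2.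
Proof. by rewrite -muln2 exprM; move: (q ^+ k) => x; ring. Qed.

Lemma mul_1D_geom (k : nat) : (0 < k)%N -> (1 + q ^+ k) * geom k.*2 = geom k.
Proof.
move=> k_gt0; have gK := geomK k_gt0.
have : (1 - q ^+ k.*2) * geom k.*2 = 1 by rewrite geomK ?double_gt0.
rewrite -mul_1DB_exp; move: (q ^+ k) (geom k) (geom k.*2) gK => x g h gK hK.
transitivity ((1 + x) * (1 - x) * h * g); last by rewrite hK mul1r.
by transitivity ((1 + x) * h * ((1 - x) * g)); [rewrite gK mulr1 | ring].
Qed.

(** By (1 + q^k)(1 - q^k) = 1 - q^(2k), multiplying the left side by all 1 - q^k leaves these
    factors for even k only; they cancel the even half of the product of all [geom k]. *)
Lemma Euler_odd_distinct :
  \prod_(i < n) (1 + q ^+ i.+1) = \prod_(i < n | ~~ odd i) geom i.+1.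
Proof.
have geom_prodK (P : pred 'I_n) :
    (\prod_(i < n | P i) (1 - q ^+ i.+1)) * \prod_(i < n | P i) geom i.+1 = 1.
  by rewrite -big_split big1 //= => i _; rewrite geomK.
have double : (\prod_(i < n) (1 + q ^+ i.+1)) * \prod_(i < n) (1 - q ^+ i.+1) =
    \prod_(i < n | odd i) (1 - q ^+ i.+1).
  rewrite -big_split /= -(@big_double _ _ _ (fun k => 1 - q ^+ k)).
    by apply: eq_bigr => i _; exact: mul_1DB_exp.
  by move=> k n_k; rewrite q_exp0 // subr0.
rewrite -[LHS]mulr1 -[X in _ * X = _](geom_prodK xpredT) mulrA double.
rewrite [X in _ * X](bigID (fun i : 'I_n => odd i)) /= mulrA.
by rewrite geom_prodK mul1r.
Qed.

Lemma term_series1 (u : nat -> nat -> nat) (k : nat) :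
  (forall j, u k j = 1%N) -> term_series u k = geom k.
Proof.
by move=> u1; apply: eq_bigr => j _; rewrite u1 mul1r.
Qed.

Lemma term_series_init (u : nat -> nat -> nat) (k : nat) :
  (forall j, (1 < j)%N -> u k j = 0%N) ->
  term_series u k = (u k 0)%:R + (u k 1)%:R * q ^+ k.
Proof.
move=> u0; rewrite /term_series.
(* With n positive, both j = 0 and j = 1 lie in the range of the sum. *)
case: n n_gt0 => // m _.
rewrite !big_ord_recl big1 /= => [|j _]; last by rewrite u0 ?mul0r.
by rewrite muln0 muln1 mulr1 addr0.
Qed.

Lemma term_series_pos (k : nat) :
  term_series (fun _ m => (0 < m)%N) k = geom k - 1.
Proof.
rewrite /term_series /geom !big_ord_recl muln0 mul0r add0r [RHS]addrC addKr.
by apply: eq_bigr => j _; rewrite mul1r.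
Qed.

(** This is the sum of m x^m, equal to x / (1 - x)^2, at x = q^k: multiplying by 1 - x replaces the
    coefficients by their differences, all 1 after the constant term. *)
Lemma term_series_mult (k : nat) : (0 < k)%N ->
  term_series (fun _ m => m) k = geom k * (geom k - 1).
Proof.
move=> k_gt0; have gK := geomK k_gt0; set s := term_series _ k.
suff sE : (1 - q ^+ k) * s = geom k - 1.
  by rewrite -sE mulrA [geom k * _]mulrC gK mul1r.
rewrite mulrBl mul1r -term_series_pos /s /term_series mulr_sumr.
rewrite big_ord_recl mul0r add0r.
rewrite [X in _ - X]big_ord_recr /= mulrCA -exprD -mulnS.
(* The shifted sum overshoots by one term, a multiple of q^(k(n+1)), which is zero. *)
rewrite (@q_exp0 (k * n.+1)); last first.
  exact: leq_pmull.
rewrite mulr0 addr0 -sumrB [RHS]big_ord_recl mul0r add0r.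
apply: eq_bigr => j _; rewrite mulrCA -exprD -mulnS lift0 -mulrBl.
by rewrite -natrB // subSnn.
Qed.

End NilpotentBase.

(** * Local weights and their Lambert series *)

Definition even_pos (k m : nat) : nat := ~~ odd k && (0 < m).
Definition odd_only (k m : nat) : nat := odd k || (m == 0).
Definition at_most_once (k m : nat) : nat := (m <= 1).
Definition repeated (k m : nat) : nat := (1 < m).
(** Marking k with the extra weight m and summing over k counts all parts of a partition that v
    admits. *)
Definition size_in (v : nat -> nat -> nat) (k m : nat) : nat := v k m * m.

Section Beck.
Local Open Scope ring_scope.
Variables (R : comNzRingType) (n : nat) (q : R).
Hypotheses (n_gt0 : (0 < n)%N) (q_nil : q ^+ n.+1 = 0).

Local Notation geom := (geom n q).
Local Notation total u v :=
  (\sum_(k < n) term_series n q u k.+1 *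
     \prod_(i < n | i != k) term_series n q v i.+1).

(** By the index shift, [P] is the product of 1 / (1 - q^k) over odd k, and [E] is the sum of q^k /
    (1 - q^k) over even k. *)
Let P : R := \prod_(i < n | ~~ odd i) geom i.+1.
Let E : R := \sum_(i < n | odd i) (geom i.+1 - 1).

Lemma term_series_odd_only (k : nat) :
  term_series n q odd_only k = if odd k then geom k else 1.
Proof.
case: ifP => k_odd.
  by rewrite term_series1 // => j; rewrite /odd_only k_odd.
rewrite /term_series big_ord_recl big1 => [|j _].
  by rewrite /odd_only k_odd /= muln0 mul1r addr0.
by rewrite /odd_only k_odd mul0r.
Qed.

Lemma prod_odd_only : \prod_(i < n) term_series n q odd_only i.+1 = P.
Proof.
rewrite /P [RHS]big_mkcond; apply: eq_bigr => i _.
by rewrite term_series_odd_only.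
Qed.

Lemma term_series_at_most_once (k : nat) :
  term_series n q at_most_once k = 1 + q ^+ k.
Proof. by rewrite term_series_init // => [|[|[|j]]]; rewrite ?mul1r. Qed.

Lemma prod_at_most_once : \prod_(i < n) term_series n q at_most_once i.+1 = P.
Proof.
rewrite -[RHS](Euler_odd_distinct q_nil).
by apply: eq_bigr => i _; exact: term_series_at_most_once.
Qed.

Lemma total_even_pos : total even_pos odd_only = P * E.
Proof.
rewrite (sum_mul_prod_neq
  (T := fun i : 'I_n => if odd i then geom i.+1 - 1 else 0)).
  by rewrite prod_odd_only -big_mkcond.
move=> i; rewrite term_series_odd_only /=; case: (boolP (odd i)) => i_odd /=.
  rewrite mul1r -term_series_pos; apply: eq_bigr => j _.
  by rewrite /even_pos /= i_odd.
by rewrite mulr0 [LHS]big1 // => j _; rewrite /even_pos /= i_odd mul0r.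
Qed.

Lemma total_size_odd : total (size_in odd_only) odd_only =
  P * \sum_(i < n | ~~ odd i) (geom i.+1 - 1).
Proof.
rewrite (sum_mul_prod_neq
  (T := fun i : 'I_n => if ~~ odd i then geom i.+1 - 1 else 0)).
  by rewrite prod_odd_only -big_mkcond.
move=> i; rewrite term_series_odd_only /=; case: (boolP (odd i)) => i_odd /=.
  rewrite mulr0 [LHS]big1 // => j _; rewrite /size_in /odd_only /= i_odd /=.
  by case: eqP => [->|_]; rewrite ?muln0 mul0r.
rewrite -term_series_mult //; apply: eq_bigr => j _.
by rewrite /size_in /odd_only /= i_odd mul1n.
Qed.

Lemma sum_geom_double : \sum_(i < n) (geom i.+1.*2 - 1) = E.
Proof.
rewrite (@big_double n _ _ _ (fun k => geom k - 1)) // => k n_k.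
by rewrite geom_eq1 ?subrr.
Qed.

(** The marked factor is [geom k] - (1 + q^k) = (1 + q^k)([geom (2k)] - 1), so all even sizes 2k
    appear, as in [E]. *)
Lemma total_repeated : total repeated at_most_once = P * E.
Proof.
rewrite (sum_mul_prod_neq (T := fun i : 'I_n => geom i.+1.*2 - 1)).
  by rewrite prod_at_most_once sum_geom_double.
move=> i; rewrite term_series_at_most_once mulrBr mulr1 mul_1D_geom //.
rewrite -term_series_at_most_once.
rewrite -[geom _](@term_series1 _ _ _ (fun _ _ => 1%N)) //.
rewrite -sumrB; apply: eq_bigr => j _; rewrite -mulrBl; congr (_ * _).
by rewrite /repeated /at_most_once ltnNge; case: leqP; rewrite ?subrr ?subr0.
Qed.

Lemma total_size_distinct : total (size_in at_most_once) at_most_once =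
  P * (\sum_(i < n) (geom i.+1 - 1) - E *+ 2).
Proof.
rewrite (sum_mul_prod_neq
  (T := fun i : 'I_n => (geom i.+1 - 1) - (geom i.+1.*2 - 1) *+ 2)).
  by rewrite prod_at_most_once sumrB sumrMnl sum_geom_double.
move=> i; rewrite term_series_at_most_once.
rewrite (term_series_init q n_gt0) => [|j]; last first.
  by rewrite /size_in /at_most_once ltnNge => /negPf ->.
have gK : (1 - q ^+ i.+1.*2) * geom i.+1.*2 = 1 by rewrite geomK ?double_gt0.
have gD := mul_1D_geom q_nil (ltn0Sn i).
(* Expressing [geom k] through [geom (2k)] leaves one inverse g, with (1 + x)(1 - x) g = 1 for x =
   q^k. *)
rewrite -gD; rewrite -mul_1DB_exp in gK.
rewrite /size_in muln0 muln1 add0r mul1r.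
move: (q ^+ _) (geom _) gK => x g gK.
by transitivity (1 + x - (1 + x) * (1 - x) * g); [rewrite gK; ring | ring].
Qed.

(** With O the sum over odd k, this is E + (E + O - 2E) = O. The additive form carries over to
    natural numbers without truncated subtraction. *)
Lemma total_even_pos_size_distinct :
  total even_pos odd_only + total (size_in at_most_once) at_most_once =
  total (size_in odd_only) odd_only.
Proof.
rewrite total_even_pos total_size_distinct total_size_odd -mulrDr.
rewrite (bigID (fun i : 'I_n => odd i)) /= -/E; congr (_ * _).
by move: E (\sum_(_ < _ | _) _) => x y; ring.
Qed.

End Beck.

(** * Extraction of the coefficient of q^n *)

Section CoefficientOfqX.
Local Open Scope ring_scope.
Variable n : nat.
Hypothesis n_gt0 : (0 < n)%N.

Local Notation trunc := {poly %/ ('X^(n.+1) : {poly int})}.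
Local Notation x := ('qX : trunc).

Let size_modulus : size (mk_monic ('X^(n.+1) : {poly int})) = n.+2.
Proof. by rewrite mk_monic_Xn size_polyXn. Qed.

Lemma qX_nil : x ^+ n.+1 = 0.
Proof.
rewrite -rmorphXn; apply: val_inj.
by rewrite /= mk_monic_Xn Pdiv.RingMonic.rmodpp // monicXn.
Qed.

Lemma coef_qXn (m : nat) : (x ^+ m : {poly int})`_n = (m == n)%:R.
Proof.
have [m_n|n_m] := leqP m n; last by rewrite (q_exp0 qX_nil) // coef0 gtn_eqF.
rewrite -rmorphXn in_qpoly_small ?size_modulus ?size_polyXn //.
by rewrite coefXn eq_sym.
Qed.

(** The coefficient of q^n keeps the functions of weight n, which are exactly the multiplicity
    functions of partitions of n. *)
Lemma coef_marked_series (u v : nat -> nat -> nat) :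
  (\sum_(k < n) term_series n x u k.+1 *
     \prod_(i < n | i != k) term_series n x v i.+1 : {poly int})`_n =
  (\sum_(p : intpart n) marked u v (mults p))%:R.
Proof.
rewrite -marked_series coefn_sum natr_sum.
rewrite (sum_mults (fun f => (marked u v f)%:R)) [RHS]big_mkcond.
apply: eq_bigr => f _; rewrite mulr_natl raddfMn coefMn coef_qXn.
by case: eqP; rewrite ?mul0rn.
Qed.

Lemma sum_marked_even_pos :
  (\sum_(p : intpart n) marked even_pos odd_only (mults p) +
   \sum_(p : intpart n) marked (size_in at_most_once) at_most_once (mults p))%N =
  \sum_(p : intpart n) marked (size_in odd_only) odd_only (mults p).
Proof.
apply/eqP; rewrite -(Num.Theory.eqr_nat int) natrD -!coef_marked_series -coefD.
by rewrite -(total_even_pos_size_distinct n_gt0 qX_nil).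
Qed.

Lemma sum_marked_repeated :
  \sum_(p : intpart n) marked repeated at_most_once (mults p) =
  \sum_(p : intpart n) marked even_pos odd_only (mults p).
Proof.
apply/eqP; rewrite -(Num.Theory.eqr_nat int) -!coef_marked_series.
by rewrite (total_repeated n_gt0 qX_nil) total_even_pos.
Qed.

End CoefficientOfqX.

(** * The four counts as marked sums *)

Lemma card_set_sum (T : finType) (P : pred T) : #|[set x | P x]| = \sum_x P x.
Proof. by rewrite cardsE -sum1_card big_mkcond. Qed.

(** The marked factor supplies the condition missing at k, so every summand is the same indicator
    times a multiplicity, and the multiplicities add up to the size. *)
Lemma marked_size_in (n : nat) (P : nat -> nat -> bool) (p : intpart n) :
  marked (size_in (fun k m => P k m)) (fun k m => P k m) (mults p) =
  [forall k : 'I_n, P k.+1 (count_mem k.+1 p)] * size p.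
Proof.
rewrite -sum1_size (sumn_count_mem _ (@part_bounds n p)) big_distrr /=.
rewrite -[X in nat_of_bool X]/[forall (k : 'I_n | xpredT k), _].
rewrite -prod_nat_of_bool; apply: eq_bigr => k _.
rewrite [in RHS](bigD1 k) //= muln1 /size_in -mulnAC multsE.
by congr (_ * _ * _); apply: eq_bigr => i _; rewrite multsE.
Qed.

Lemma a_marked (n : nat) :
  a n = \sum_(p : intpart n) marked even_pos odd_only (mults p).
Proof.
rewrite /a card_set_sum; apply: eq_bigr => p _.
have mem_ev k : (k \in even_values p) = ~~ odd k && (0 < count_mem k p).
  by rewrite mem_undup mem_filter -has_count has_pred1.
rewrite (@uniq_size_eq1_sum n) ?undup_uniq //; last first.
  by move=> k; rewrite mem_undup mem_filter => /andP[_ /part_bounds].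
apply: eq_bigr => k _; rewrite mem_ev /even_pos multsE; congr (_ * _).
apply: eq_bigr => i _; rewrite mem_ev /odd_only multsE.
by rewrite negb_and negbK -eqn0Ngt.
Qed.

Lemma c_marked (n : nat) :
  c n = \sum_(p : intpart n) marked repeated at_most_once (mults p).
Proof.
rewrite /c card_set_sum; apply: eq_bigr => p _.
have mem_rep k : (k \in repeated_values p) = (1 < count_mem k p).
  rewrite mem_filter mem_undup andb_idr // => /ltnW.
  by rewrite -has_count has_pred1.
rewrite (@uniq_size_eq1_sum n) ?filter_uniq ?undup_uniq //; last first.
  by move=> k; rewrite mem_filter mem_undup => /andP[_ /part_bounds].
apply: eq_bigr => k _; rewrite mem_rep /repeated multsE; congr (_ * _).
by apply: eq_bigr => i _; rewrite mem_rep /at_most_once multsE -leqNgt.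
Qed.

Lemma size_odd_marked (n : nat) :
  \sum_(p : intpart n | all odd p) size p =
  \sum_(p : intpart n) marked (size_in odd_only) odd_only (mults p).
Proof.
rewrite big_mkcond; apply: eq_bigr => p _.
rewrite (marked_size_in (fun k m => odd k || (m == 0))) mulnbl.
congr (if _ then _ else _); apply/allP/forallP => [p_odd k|p_odd x xp].
  rewrite -implyNb; apply/implyP => k_even; apply/eqP/count_memPn.
  by apply: contra k_even => /p_odd.
have [k xE] := ord_succ_surj (part_bounds xp); have := p_odd k.
by rewrite -xE eqn0Ngt -has_count has_pred1 xp orbF.
Qed.

Lemma size_distinct_marked (n : nat) :
  \sum_(p : intpart n | uniq p) size p =
  \sum_(p : intpart n) marked (size_in at_most_once) at_most_once (mults p).
Proof.
rewrite big_mkcond; apply: eq_bigr => p _.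
rewrite (marked_size_in (fun _ m => m <= 1)) mulnbl.
congr (if _ then _ else _); apply/idP/forallP => [p_uniq k|p_le1].
  by rewrite count_uniq_mem ?leq_b1.
apply: count_mem_uniq => x; have [xp|/count_memPn -> //] := boolP (x \in _).
have [k xE] := ord_succ_surj (part_bounds xp); have := p_le1 k.
by rewrite -xE => cnt_le1; apply/eqP;
  rewrite eqn_leq cnt_le1 -has_count has_pred1.
Qed.

Theorem theorem1 (n : nat) (hn : 1 <= n) :
  Posz (a n) = b n /\ Posz (c n) = b n.
Proof.
have aE : Posz (a n) = b n.
  (* The odd total becomes the [a] sum plus the distinct total, which the subtraction in [b]
     cancels. *)
  by rewrite /b size_odd_marked -sum_marked_even_pos //
    size_distinct_marked PoszD addrK a_marked.
by split=> //; rewrite -aE a_marked c_marked sum_marked_repeated.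
Qed.
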